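(* Let $Q$ be a quiver with nodes $1,\dots,n$ and let $G\subset S_n$ be a finite group acting on $Q$ by quiver isomorphisms. Let $O_1,\dots,O_m$ be the orbits of $G$ on the nodes of $Q$ and choose a representative $x_k\in O_k$ for each $k$. Then the folded exchange matrix $B^Q_G(x_1,\dots,x_m)$ is a $\sigma$ skew-symmetrizable matrix over the group ring $\mathbb{Z}[G][|G|^{-1}]$.
   Context: A quiver is a finite directed graph (multiple arrows allowed) without loops and without oriented 2-cycles. Its exchange matrix $B^Q=(b_{uv})$ is the skew-symmetric integer matrix with $b_{uv}=l$ if there are $l$ arrows from $u$ to $v$, $b_{uv}=-l$ if there are $l$ arrows from $v$ to $u$, and $b_{uv}=0$ otherwise. $G\subset S_n$ acts on $Q$ by quiver isomorphisms if $b_{g\cdot u,\,g\cdot v}=b_{uv}$ for all $g\in G$ and all nodes $u,v$. Write $R=\mathbb{Z}[G][|G|^{-1}]$ for the group ring of the finite group $G$ with $|G|$ inverted (i.e. the group ring of $G$ over $\mathbb{Z}[1/|G|]$), with anti-involution $\sigma$ the linear extension of $\sigma(g)=g^{-1}$. Folded exchange matrix: let $H_k=\mathrm{Stab}_G(x_k)$, and for $g\in G$ let $B^Q_{x_ix_j}(g)=b_{x_i,\,g\cdot x_j}$ be the signed number of arrows from $x_i$ to $g\cdot x_j$. Then $B^Q_G(x_1,\dots,x_m)=(c_{ij})$ is the $m\times m$ matrix over $R$ with $$c_{ij}=\frac{1}{|H_j|}\sum_{g\in G}B^Q_{x_ix_j}(g)\,g .$$ A matrix $B=(b_{ij})\in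 M_m(R)$ is $\sigma$ skew-symmetric if $b_{ij}=-\sigma(b_{ji})$ for all $i,j$. It is $\sigma$ skew-symmetrizable if there is a diagonal matrix $D$, whose diagonal entries lie in the center of $R$ and are fixed by $\sigma$, such that $DB$ is $\sigma$ skew-symmetric. *)

(* Defs.v *)
From HB Require Import structures.
From mathcomp Require Import all_boot all_order all_algebra all_fingroup.

Set Implicit Arguments.
Unset Strict Implicit.
Unset Printing Implicit Defensive.

Import Order.TTheory GRing.Theory Num.Theory.
Local Open Scope ring_scope.

(* Z[1/N] inside rat: all prime factors of the denominator divide N; see
   inv_intP for the usual description. *)
Definition inv_int_pred (N : nat) : {pred rat} :=
  fun x => \pi(N).-nat `|denq x|%N.

Lemma inv_int_predP (N : nat) (x : rat) :
  reflect (exists2 t : nat, \pi(N).-nat t & t%:R * x \is a Num.int)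
          (x \in inv_int_pred N).
Proof.
apply: (iffP idP) => [Nx | [t Nt /intrP[z tx]]].
  exists `|denq x|%N => //; apply/intrP; exists (numq x).
  by rewrite numqE mulrC natr_absz ger0_norm ?denq_ge0.
have {}tx : t%:Z * numq x = z * denq x.
  by apply/eqP; rewrite -(eqr_int rat) !intrM numqE -tx mulrA pmulrn.
have cop : coprime `|denq x| `|numq x| by rewrite coprime_sym coprime_num_den.
apply: pnat_dvd Nt; rewrite -(Gauss_dvdl _ cop).
by have := congr1 absz tx; rewrite !abszM /= => ->; rewrite dvdn_mull.
Qed.

Lemma inv_intP (N : nat) (x : rat) : (0 < N)%N ->
  reflect (exists k : nat, (N ^ k)%:R * x \is a Num.int)
          (x \in inv_int_pred N).
Proof.
move=> N_gt0; apply: (iffP (inv_int_predP N x)) => [[t Nt tx] | [k Nx]].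
  have t_gt0 : (0 < t)%N by case/andP: Nt.
  have /dvdnP[q Nq] : (t %| N ^ t)%N.
    apply/dvdn_partP => // p pt; have Np := pnatPpi Nt pt.
    have p_pr : prime p by move: pt; rewrite mem_primes => /andP[].
    rewrite p_part pfactor_dvdn ?expn_gt0 ?N_gt0 // lognX.
    apply: (@leq_trans t); first exact/ltnW/ltn_logl.
    by rewrite leq_pmulr // logn_gt0.
  by exists t; rewrite Nq natrM -mulrA rpredM // ?natr_int.
by exists (N ^ k)%N => //; rewrite pnatX pnat_pi.
Qed.

Fact inv_int_subring_closed N : subring_closed (inv_int_pred N).
Proof.
split=> [|x y /inv_int_predP[s Ns sx] /inv_int_predP[t Nt ty]
         |x y /inv_int_predP[s Ns sx] /inv_int_predP[t Nt ty]].
- by apply/inv_int_predP; exists 1%N; rewrite ?mulr1.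
- apply/inv_int_predP; exists (s * t)%N; first by rewrite pnatM Ns.
  rewrite mulrBr natrM -[X in _ - X]mulrA [_ * _ * x]mulrAC.
  by rewrite rpredB // rpredM ?natr_int.
- apply/inv_int_predP; exists (s * t)%N; first by rewrite pnatM Ns.
  by rewrite natrM mulrACA rpredM.
Qed.

HB.instance Definition _ N :=
  GRing.isSubringClosed.Build rat (inv_int_pred N) (inv_int_subring_closed N).

Record inv_int (N : nat) : predArgType :=
  InvInt { inv_int_val :> rat; _ : inv_int_val \in inv_int_pred N }.

HB.instance Definition _ N := [isSub for @inv_int_val N].
HB.instance Definition _ N := [Choice of inv_int N by <:].
HB.instance Definition _ N := [SubChoice_isSubComNzRing of inv_int N by <:].

Section InvIntUnit.
Variable N : nat.
Implicit Types x y : inv_int N.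

Definition inv_int_unit : {pred inv_int N} :=
  fun x => (val x != 0) && ((val x)^-1 \in inv_int_pred N).

Definition inv_int_inv x : inv_int N := insubd x (val x)^-1.

Fact inv_int_mulVr : {in inv_int_unit, left_inverse 1 inv_int_inv *%R}.
Proof.
move=> x /andP[x0 Nx]; apply: val_inj.
by rewrite rmorphM rmorph1 /= /inv_int_inv val_insubd Nx mulVf.
Qed.

Fact inv_int_unitP x y : y * x = 1 -> inv_int_unit x.
Proof.
move/(congr1 val); rewrite rmorphM rmorph1 /= => yx1.
have x0 : val x != 0.
  by apply: contra_eq_neq yx1 => ->; rewrite mulr0 eq_sym oner_eq0.
by rewrite /inv_int_unit x0 -[_^-1]mul1r -yx1 mulfK // (valP y).
Qed.

Fact inv_int_invr_out : {in [predC inv_int_unit], inv_int_inv =1 id}.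
Proof.
move=> x; rewrite inE negb_and negbK => /orP[/eqP x0 | Nx]; apply: val_inj;
  rewrite /inv_int_inv val_insubd.
  by case: ifP => // _; rewrite x0 invr0.
by rewrite (negPf Nx).
Qed.

HB.instance Definition _ := GRing.ComNzRing_hasMulInverse.Build (inv_int N)
  inv_int_mulVr inv_int_unitP inv_int_invr_out.

End InvIntUnit.

Lemma inv_int_natr_unit (N d : nat) : (0 < N)%N -> (d %| N)%N ->
  (d%:R : inv_int N) \is a GRing.unit.
Proof.
move=> N_gt0 dN; have d_gt0 := dvdn_gt0 N_gt0 dN.
have Nd : (d%:R : rat)^-1 \in inv_int_pred N.
  apply/inv_int_predP; exists d; first exact: pnat_dvd dN (pnat_pi N_gt0).
  by rewrite divff ?pnatr_eq0 -?lt0n.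
apply/unitrP; exists (InvInt Nd).
suff E : InvInt Nd * d%:R = 1 by rewrite [d%:R * _]mulrC.
by apply: val_inj; rewrite rmorphM rmorph1 rmorph_nat mulVf ?pnatr_eq0 -?lt0n.
Qed.

Definition group_ring (A : comNzRingType) (gT : finGroupType) : Type :=
  {ffun gT -> A}.

Section GroupRing.
Variables (A : comNzRingType) (gT : finGroupType).
Local Notation AG := (group_ring A gT).
Implicit Types (a b : A) (e f : AG) (g h : gT).

HB.instance Definition _ := GRing.Zmodule.on AG.

Definition gr_scale a f : AG := [ffun g => a * f g].

Fact gr_scaleA a b f : gr_scale a (gr_scale b f) = gr_scale (a * b) f.
Proof. by apply/ffunP=> g; rewrite !ffunE mulrA. Qed.
Fact gr_scale1 : left_id 1 gr_scale.
Proof. by move=> f; apply/ffunP=> g; rewrite !ffunE mul1r. Qed.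
Fact gr_scaleDr : right_distributive gr_scale +%R.
Proof. by move=> a e f; apply/ffunP=> g; rewrite !ffunE mulrDr. Qed.
Fact gr_scaleDl f : {morph gr_scale^~ f : a b / a + b}.
Proof. by move=> a b; apply/ffunP=> g; rewrite !ffunE mulrDl. Qed.

HB.instance Definition _ := GRing.Zmodule_isLmodule.Build A AG
  gr_scaleA gr_scale1 gr_scaleDr gr_scaleDl.

Definition gr_elt g : AG := [ffun h => (h == g)%:R].

Definition gr_mul e f : AG := [ffun g => \sum_h e h * f (h^-1 * g)%g].

Fact gr_mulA : associative gr_mul.
Proof.
move=> d e f; apply/ffunP=> g; rewrite !ffunE.
under eq_bigr do rewrite ffunE mulr_sumr.
under [RHS]eq_bigr do rewrite ffunE mulr_suml.
rewrite [RHS]exchange_big /=; apply: eq_bigr => h _.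
rewrite [RHS](reindex_inj (mulgI h)) /=; apply: eq_bigr => k _.
by rewrite mulKg invMg !mulgA mulrA.
Qed.

Fact gr_mul1l : left_id (gr_elt 1%g) gr_mul.
Proof.
move=> f; apply/ffunP=> g; rewrite !ffunE (bigD1 1%g) //= ffunE eqxx mul1r.
by rewrite invg1 mul1g big1 ?addr0 // => h /negPf h1; rewrite ffunE h1 mul0r.
Qed.

Fact gr_mul1r : right_id (gr_elt 1%g) gr_mul.
Proof.
move=> f; apply/ffunP=> g; rewrite !ffunE (bigD1 g) //= ffunE mulVg eqxx mulr1.
rewrite big1 ?addr0 // => h hg; rewrite ffunE -eq_mulVg1 (negPf hg).
by rewrite mulr0.
Qed.

Fact gr_mulDl : left_distributive gr_mul +%R.
Proof.
move=> d e f; apply/ffunP=> g; rewrite !ffunE -big_split.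
by apply: eq_bigr => h _; rewrite ffunE mulrDl.
Qed.

Fact gr_mulDr : right_distributive gr_mul +%R.
Proof.
move=> d e f; apply/ffunP=> g; rewrite !ffunE -big_split.
by apply: eq_bigr => h _; rewrite ffunE mulrDr.
Qed.

Fact gr_elt1_neq0 : gr_elt 1%g != 0.
Proof. by apply/eqP=> /ffunP/(_ 1%g)/eqP; rewrite !ffunE eqxx oner_eq0. Qed.

HB.instance Definition _ := GRing.Zmodule_isNzRing.Build AG
  gr_mulA gr_mul1l gr_mul1r gr_mulDl gr_mulDr gr_elt1_neq0.

Fact gr_scaleAl a e f : a *: (e * f) = (a *: e) * f.
Proof.
apply/ffunP=> g; rewrite !ffunE mulr_sumr.
by apply: eq_bigr => h _; rewrite ffunE mulrA.
Qed.

HB.instance Definition _ := GRing.Lmodule_isLalgebra.Build A AG gr_scaleAl.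

Fact gr_scaleAr a e f : a *: (e * f) = e * (a *: f).
Proof.
apply/ffunP=> g; rewrite !ffunE mulr_sumr.
by apply: eq_bigr => h _; rewrite ffunE mulrCA.
Qed.

HB.instance Definition _ := GRing.Lalgebra_isAlgebra.Build A AG gr_scaleAr.

Lemma gr_eltM g h : gr_elt g * gr_elt h = gr_elt (g * h)%g.
Proof.
apply/ffunP=> k; rewrite !ffunE (bigD1 g) //= !ffunE eqxx mul1r.
rewrite big1 ?addr0 => [|l /negPf lg]; last by rewrite ffunE lg mul0r.
by rewrite -(inj_eq (mulgI g)) mulKVg.
Qed.

Lemma gr_eltE f : f = \sum_g f g *: gr_elt g.
Proof.
apply/ffunP=> h; rewrite sum_ffunE (bigD1 h) //= !ffunE eqxx mulr1.
rewrite big1 ?addr0 // => g /negPf gh.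
by rewrite !ffunE eq_sym gh mulr0.
Qed.

Definition gr_sigma f : AG := \sum_g f g *: gr_elt g^-1%g.

Lemma gr_sigmaE f g : gr_sigma f g = f g^-1%g.
Proof.
rewrite sum_ffunE (bigD1 g^-1%g) //= !ffunE invgK eqxx mulr1.
rewrite big1 ?addr0 // => h hg; rewrite !ffunE.
by rewrite -(inj_eq invg_inj) invgK eq_sym (negPf hg) mulr0.
Qed.

Lemma gr_sigmaM e f : gr_sigma (e * f) = gr_sigma f * gr_sigma e.
Proof.
apply/ffunP=> g; rewrite gr_sigmaE !ffunE.
rewrite (reindex_inj (mulgI g^-1%g)) /=; apply: eq_bigr => h _.
by rewrite !gr_sigmaE !invMg !invgK mulgK mulrC.
Qed.

Section SigmaMatrices.
Variable m : nat.
Implicit Types B D : 'M[AG]_m.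

Definition sigma_skew B : Prop := forall i j, B i j = - gr_sigma (B j i).

Definition sigma_skew_symmetrizer D B : Prop :=
  [/\ is_diag_mx D,
      forall i (r : AG), D i i * r = r * D i i,
      forall i, gr_sigma (D i i) = D i i
    & sigma_skew (D *m B)].

Definition sigma_skew_symmetrizable B : Prop :=
  exists D, sigma_skew_symmetrizer D B.

Definition invertible_mx D : Prop :=
  exists E : 'M[AG]_m, D *m E = 1%:M /\ E *m D = 1%:M.

End SigmaMatrices.

End GroupRing.

(* The elements of G as a group under composition of functions: MathComp's own
   product on 'S_n is (s * t) u = t (s u), so that u |-> g u would be a right
   action.  With the product below it is a left action, see permcM. *)
Definition comp_group n (G : {group 'S_n}) : Type := subg_of G.

Section CompGroup.
Variables (n : nat) (G : {group 'S_n}).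

HB.instance Definition _ := Finite.on (comp_group G).

Definition cg_mul (g h : comp_group G) : comp_group G :=
  ((h : subg_of G) * (g : subg_of G))%g.
Definition cg_one : comp_group G := (1 : subg_of G)%g.
Definition cg_inv (g : comp_group G) : comp_group G := ((g : subg_of G)^-1)%g.

Fact cg_mulA : associative cg_mul.
Proof. by move=> g h k; rewrite /cg_mul mulgA. Qed.
Fact cg_mul1 : left_id cg_one cg_mul.
Proof. by move=> g; rewrite /cg_mul mulg1. Qed.
Fact cg_mulV : left_inverse cg_one cg_inv cg_mul.
Proof. by move=> g; rewrite /cg_mul mulgV. Qed.

HB.instance Definition _ :=
  Finite_isGroup.Build (comp_group G) cg_mulA cg_mul1 cg_mulV.

Definition permc (g : comp_group G) : 'S_n := sgval (g : subg_of G).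

Lemma permcM g h u : permc (g * h)%g u = permc g (permc h u).
Proof. by rewrite /permc /= permM. Qed.

End CompGroup.

(* Z[G][1/|G|] *)
Definition folding_ring n (G : {group 'S_n}) :=
  group_ring (inv_int #|G|) (comp_group G).

Record quiver (n : nat) := Quiver {
  arrow : finType;
  source : arrow -> 'I_n;
  target : arrow -> 'I_n;
  quiver_no_loop : forall a, source a != target a;
  quiver_no_2cycle : forall a b,
    ~~ ((source a == target b) && (target a == source b)) }.

Section Quiver.
Variables (n : nat) (Q : quiver n).

Definition arrows_count (u v : 'I_n) : nat :=
  #|[set a : arrow Q | (source a == u) && (target a == v)]|.

(* There are never arrows in both directions. *)
Definition exchange_mx : 'M[int]_n :=
  \matrix_(u, v) if (0 < arrows_count u v)%N then (arrows_count u v)%:Z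
                 else - (arrows_count v u)%:Z.

Variable G : {group 'S_n}.

Definition acts_on_quiver : Prop :=
  forall g u v, g \in G -> exchange_mx (g u) (g v) = exchange_mx u v.

Variables (m : nat) (x : 'I_m -> 'I_n).

Definition folded_exchange_mx : 'M[folding_ring G]_m :=
  \matrix_(i, j)
    ((#|('C_G[x j | 'P])%g|%:R : inv_int #|G|)^-1 *:
      \sum_(g : comp_group G)
        gr_elt (inv_int #|G|) g *~ exchange_mx (x i) (permc g (x j))).

End Quiver.

(* Main.v *)
(* With b the exchange matrix of Q, the symmetrizer is the scalar diagonal
   matrix D = diag(1/|H_i|): the coefficient at g of D_i c_ij is
   b(x_i, g x_j) / (|H_i| |H_j|), and G-invariance gives
   b(x_j, g^-1 x_i) = b(g x_j, x_i) = - b(x_i, g x_j).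
   D is invertible since |H_i| divides |G|. *)
Require Import Defs.
From mathcomp Require Import all_boot all_order all_algebra all_fingroup.

Set Implicit Arguments.
Unset Strict Implicit.
Unset Printing Implicit Defensive.

Import Order.TTheory GRing.Theory Num.Theory.
Local Open Scope ring_scope.

(** An arrow each way would form an oriented 2-cycle. *)
Lemma arrows_count_antisym n (Q : quiver n) u v :
  (0 < arrows_count Q u v)%N -> arrows_count Q v u = 0%N.
Proof.
case/card_gt0P=> a; rewrite inE => /andP[/eqP su /eqP tv].
apply: eq_card0 => b; rewrite inE -su -tv andbC.
apply/negbTE; rewrite eq_sym [source b == _]eq_sym.
exact: quiver_no_2cycle.
Qed.

Lemma exchange_mx_skew n (Q : quiver n) u v :
  exchange_mx Q u v = - exchange_mx Q v u.
Proof.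
rewrite !mxE; have [uv|] := ltnP 0%N (arrows_count Q u v).
  by rewrite (arrows_count_antisym uv) opprK.
by rewrite leqn0 => /eqP ->; case: ltnP => // /[!leqn0] /eqP ->; rewrite oppr0.
Qed.

Lemma permcV n (G : {group 'S_n}) (g : comp_group G) u :
  permc g (permc g^-1%g u) = u.
Proof. by rewrite -permcM mulgV /permc perm1. Qed.

(** Invariance under [g] is applied to the pair [u], [g^-1 v]. *)
Lemma exchange_mx_permcV n (Q : quiver n) (G : {group 'S_n}) :
  acts_on_quiver Q G -> forall (g : comp_group G) u v,
  exchange_mx Q u (permc g^-1%g v) = exchange_mx Q (permc g u) v.
Proof.
move=> Q_G g u v; rewrite -{2}[v](permcV g) Q_G //; exact: subgP.
Qed.

Lemma folded_exchange_mxE n (Q : quiver n) (G : {group 'S_n}) m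
    (x : 'I_m -> 'I_n) i j (g : comp_group G) :
  folded_exchange_mx Q G x i j g =
  (#|('C_G[x j | 'P])%g|%:R : inv_int #|G|)^-1 *
    (exchange_mx Q (x i) (permc g (x j)))%:~R.
Proof.
rewrite mxE ffunE; congr (_ * _).
rewrite sum_ffunE (bigD1 g) //= big1 => [|h /negPf hg].
  by rewrite addr0 ffunMzE ffunE eqxx.
by rewrite ffunMzE ffunE eq_sym hg mul0rz.
Qed.

Section ScalarSymmetrizer.
Variables (A : comNzRingType) (gT : finGroupType) (m : nat) (d : 'I_m -> A).
Local Notation AG := (group_ring A gT).

(** Scalar multiples of the group ring identity are central and fixed by sigma, so only the skew
    condition depends on [d]. *)
Definition scalar_diag_mx : 'M[AG]_m := diag_mx (\row_i (d i)%:A).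

Lemma gr_sigma_alg (a : A) : gr_sigma (a%:A : AG) = a%:A.
Proof.
apply/ffunP=> g; rewrite gr_sigmaE !ffunE.
by rewrite -(inj_eq invg_inj) invgK invg1.
Qed.

(** Since sigma moves the coefficient at [g^-1] to [g], the skew condition can be checked one
    coefficient at a time. *)
Lemma scalar_diag_mxP (B : 'M[AG]_m) :
  (forall i j g, d i * B i j g = - (d j * B j i g^-1%g)) ->
  sigma_skew_symmetrizer scalar_diag_mx B.
Proof.
move=> dB; split=> [|i r|i|i j].
- exact: diag_mx_is_diag.
- by rewrite !mxE eqxx mulr1n mulr_algl mulr_algr.
- by rewrite !mxE eqxx mulr1n gr_sigma_alg.
- rewrite !mul_diag_mx !mxE !mulr_algl; apply/ffunP=> g.
  by rewrite [RHS]ffunE gr_sigmaE !ffunE dB.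
Qed.

End ScalarSymmetrizer.

Lemma scalar_diag_mx_invertible (A : comUnitRingType) (gT : finGroupType) m
    (d : 'I_m -> A) :
  (forall i, d i \is a GRing.unit) -> invertible_mx (scalar_diag_mx gT d).
Proof.
move=> Ud; exists (scalar_diag_mx gT (fun i => (d i)^-1)).
split; rewrite mulmx_diag -diag_const_mx; congr diag_mx; apply/rowP=> i;
  by rewrite !mxE mulr_algl scalerA ?mulrV ?mulVr // scale1r.
Qed.

(* As defined, sigma_skew_symmetrizable allows the zero symmetrizer; the second
   conjunct says that the symmetrizer can be taken invertible. *)
Theorem theorem3p4 (n : nat) (Q : quiver n) (G : {group 'S_n})
  (Q_G : acts_on_quiver Q G)
  (m : nat) (O : 'I_m -> {set 'I_n}) (O_inj : injective O)
  (O_orbits : [set O k | k : 'I_m] = [set orbit 'P%act G u | u : 'I_n])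
  (x : 'I_m -> 'I_n) (xO : forall k, x k \in O k) :
  sigma_skew_symmetrizable (folded_exchange_mx Q G x) /\
  exists2 D, sigma_skew_symmetrizer D (folded_exchange_mx Q G x)
           & invertible_mx D.
Proof.
pose N := #|G|; pose h i : inv_int N := (#|('C_G[x i | 'P])%g|%:R)^-1.
(* In [inv_int], [^-1] returns a non-unit unchanged; by Lagrange, [h i] is a genuine inverse of the
   stabilizer order. *)
have h_unit i : h i \is a GRing.unit.
  by rewrite unitrV inv_int_natr_unit ?cardG_gt0 ?cardSg ?subsetIl.
suff hB : sigma_skew_symmetrizer (scalar_diag_mx (comp_group G) h)
            (folded_exchange_mx Q G x).
  split; first by exists (scalar_diag_mx (comp_group G) h).
  by exists (scalar_diag_mx (comp_group G) h) => //;
    exact: scalar_diag_mx_invertible.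
apply: scalar_diag_mxP => i j g; rewrite !folded_exchange_mxE -/(h i) -/(h j).
rewrite (exchange_mx_permcV Q_G) (exchange_mx_skew Q (permc g (x j))).
(* The signs cancel, and the two sides differ only in the order of [h i] and [h j]. *)
by rewrite mulrNz !mulrN opprK mulrCA.
Qed.
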